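(* Fix $\epsilon>0$ and $\alpha\in(1,\infty)$. For each prior $\rho$ and pair $(s_i,s_j)\in\mathbb{S}$, let $\pi^*_{i,j,\rho}$ be the comonotone coupling of $P_{X|s_i,\rho}$ and $P_{X|s_j,\rho}$ and suppose $\sigma^2_{i,j,\rho}>0$ satisfies $$\int e^{\alpha(\alpha-1)\frac{(x-x')^2}{2\sigma^2_{i,j,\rho}}}\,\mathrm{d}\pi^*_{i,j,\rho}(x,x')=e^{(\alpha-1)\epsilon}.$$ Let $\sigma^2$ be the maximum of $\sigma^2_{i,j,\rho}$ over all $(s_i,s_j)\in\mathbb{S}$ and all $\rho$ (assumed to exist). Then releasing $Y=X+N$ with $N$ Gaussian of mean $0$ and variance $\sigma^2$ (density $\frac{1}{\sqrt{2\pi}\sigma}e^{-z^2/(2\sigma^2)}$), independent of $(X,S)$, attains $(\alpha,\epsilon)$-Rényi pufferfish privacy.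
   Context: Setting: a sensitive secret $S$ and real-valued data $X$. For each secret value $s$ and each adversarial prior belief $\rho$ (ranging over a given set of priors), $X$ given $S=s$ has a density $P_{X|s,\rho}$ on $\mathbb{R}$. $\mathbb{S}$ is a given set of ordered secret pairs. The released data is $Y=X+N$ with $N$ independent of $(X,S)$, so $P_{Y|S}(y|s,\rho)=\int P_N(y-x)P_{X|S}(x|s,\rho)\,\mathrm{d}x$. For densities $P\ll Q$, $D_\alpha(P\|Q)=\frac{1}{\alpha-1}\log\int P^\alpha Q^{1-\alpha}$. $Y$ satisfies $(\alpha,\epsilon)$-Rényi pufferfish privacy if $D_\alpha(P_{Y|s_i,\rho}\|P_{Y|s_j,\rho})\le\epsilon$ for all $\rho$ and all $(s_i,s_j)\in\mathbb{S}$. The comonotone (Kantorovich optimal) coupling of two distributions on $\mathbb{R}$ with CDFs $F_i,F_j$ is the joint distribution with joint CDF $\min\{F_i(x),F_j(x')\}$, i.e. the law of $(F_i^{-1}(U),F_j^{-1}(U))$, $U\sim\mathrm{Unif}(0,1)$. *)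

(* Defs.v *)
From HB Require Import structures.
From mathcomp Require Import all_boot all_order all_algebra.
From mathcomp Require Import all_classical all_reals all_analysis.
Set Implicit Arguments. Unset Strict Implicit. Unset Printing Implicit Defensive.
Import Order.TTheory GRing.Theory Num.Theory.
Import numFieldNormedType.Exports.
Local Open Scope classical_set_scope.
Local Open Scope ring_scope.

Section Defs.
Variable R : realType.
Notation leb := (@lebesgue_measure R).

Definition is_density (p : R -> R) : Prop :=
  (forall x, 0 <= p x) /\ measurable_fun setT p /\
  (\int[leb]_x (p x)%:E = 1)%E.

Definition cdf (p : R -> R) (x : R) : R :=
  fine (\int[leb]_(t in `]-oo, x%R]) (p t)%:E)%E.

Definition quantile (p : R -> R) (u : R) : R :=
  inf [set x | u <= cdf p x].

(* integral of g against the comonotone coupling of the laws with densities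
   p and q: the law of (F_p^{-1}(U), F_q^{-1}(U)) with U ~ Unif(0,1) *)
Definition comonotone_integral (p q : R -> R) (g : R -> R -> R) : \bar R :=
  (\int[leb]_(u in `]0%R, 1%R[) (g (quantile p u) (quantile q u))%:E)%E.

Definition gauss (s2 : R) (z : R) : R :=
  (Num.sqrt (2 * pi) * Num.sqrt s2)^-1 * expR (- (z ^+ 2) / (2 * s2)).

(* density of Y = X + N, N with density pN independent of X with density pX *)
Definition conv_density (pN pX : R -> R) (y : R) : R :=
  fine (\int[leb]_x (pN (y - x) * pX x)%:E)%E.

Definition renyi_div (alpha : R) (P Q : R -> R) : \bar R :=
  match (\int[leb]_y (P y `^ alpha * Q y `^ (1 - alpha))%:E)%E with
  | r%:E => if 0 < r then (ln r / (alpha - 1))%:E else -oo%E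
  | +oo%E => +oo%E
  | -oo%E => -oo%E
  end.

Definition abs_cont (P Q : R -> R) : Prop :=
  leb.-negligible [set y | Q y = 0 /\ P y != 0].

Definition renyi_pufferfish (Sec Prior : Type) (SS : Sec -> Sec -> Prop)
    (PY : Sec -> Prior -> R -> R) (alpha eps : R) : Prop :=
  forall (rho : Prior) (si sj : Sec), SS si sj ->
    abs_cont (PY si rho) (PY sj rho) /\
    (renyi_div alpha (PY si rho) (PY sj rho) <= eps%:E)%E.
End Defs.

(* Main.v *)
Require Import Defs.
From HB Require Import structures.
From mathcomp Require Import all_boot all_order all_algebra.
From mathcomp Require Import all_classical all_reals all_analysis.
From mathcomp Require Import measurable_realfun ring.

Set Implicit Arguments.
Unset Strict Implicit.
Unset Printing Implicit Defensive.

Import Order.TTheory GRing.Theory Num.Theory.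
Import numFieldNormedType.Exports.
Local Open Scope ring_scope.
Local Open Scope classical_set_scope.

(* Let U be uniform on ]0, 1[ and let a, b be the quantile functions of the two
   conditional laws p, q.  As a(U) and b(U) have laws p and q, the densities of
   Y given either secret are the means of g(y - a(U)) and g(y - b(U)), with g
   the Gaussian density.  By Hoelder's inequality, the Renyi integrand at y is
   at most the mean of g(y - a(U))^alpha g(y - b(U))^(1 - alpha).  Integrating
   over y with Tonelli's theorem and completing the square gives the mean of
   exp(alpha (alpha - 1) (a(U) - b(U))^2 / (2 s2)), that is, the integral
   against the comonotone coupling, which decreases in s2. *)

Section density_prob.
Context {d : measure_display} {T : measurableType d} {R : realType}.
Context {mu : {sigma_finite_measure set T -> \bar R}} {p : T -> R}.

Definition density_prob (p_ge0 : forall t, 0 <= p t)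
    (mp : measurable_fun setT p) (p_int1 : (\int[mu]_t (p t)%:E = 1)%E) :
    set T -> \bar R :=
  fun A => (\int[mu]_(t in A) (p t)%:E)%E.

Hypotheses (p_ge0 : forall t, 0 <= p t) (mp : measurable_fun setT p)
  (p_int1 : (\int[mu]_t (p t)%:E = 1)%E).
Local Notation P := (density_prob p_ge0 mp p_int1).

Let p_ge0E t : (0 <= (p t)%:E)%E. Proof. by rewrite lee_fin. Qed.

Let mpE A : measurable_fun A (fun t => (p t)%:E).
Proof. exact/measurable_EFinP/measurable_funTS. Qed.

Let P0 : P set0 = 0%E. Proof. exact: integral_set0. Qed.

Let P_ge0 A : (0 <= P A)%E. Proof. exact: integral_ge0. Qed.

Let P_sigma_additive : semi_sigma_additive P.
Proof.
move=> F mF tF mUF; rewrite /density_prob; apply: cvg_toP.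
  apply: ereal_nondecreasing_is_cvgn => m n mn.
  by apply: lee_sum_nneg_natr => // k _ _; exact: integral_ge0.
by rewrite ge0_integral_bigcup.
Qed.

HB.instance Definition _ := isMeasure.Build _ _ _ P P0 P_ge0 P_sigma_additive.

HB.instance Definition _ := Measure_isProbability.Build _ _ R P p_int1.

Lemma density_prob_dominates : P `<< mu.
Proof.
by apply/null_content_dominatesP => A mA A0; exact: null_set_integral.
Qed.

Lemma ge0_integral_density_prob (h : T -> \bar R) :
  measurable_fun setT h -> (forall t, 0 <= h t)%E ->
  (\int[P]_t h t = \int[mu]_t (h t * (p t)%:E))%E.
Proof.
move=> mh h0; have dom := density_prob_dominates.
have mdP := Radon_Nikodym_SigmaFinite.f_integrable dom.
rewrite -(Radon_Nikodym_SigmaFinite.change_of_variables dom)//.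
apply: ae_eq_integral => //.
- by apply: emeasurable_funM => //; exact: measurable_int mdP.
- exact: emeasurable_funM.
- apply: ae_eqe_mul2l; apply: integral_ae_eq => // A _ mA.
  by rewrite -Radon_Nikodym_SigmaFinite.f_integral.
Qed.

End density_prob.
Arguments density_prob {d T R} mu {p} p_ge0 mp p_int1.

Lemma eq_cdf_probability {R : realType} (P Q : probability R R) :
  (forall x, P `]-oo, x] = Q `]-oo, x]) ->
  forall A, measurable A -> P A = Q A.
Proof.
move=> eqPQ; have eqPQoy x : P `]x, +oo[ = Q `]x, +oo[.
  by rewrite -setCitvl !probability_setC// eqPQ.
apply: (measure_unique (T := R)
  (@RGenOInfty.G R) (fun n => `](- n%:R), +oo[)) => //.
- exact: RGenOInfty.measurableE.
- move=> _ _ [x ->] [y ->]; exists (Num.max x y).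
  by apply/seteqP; split=> z /=; rewrite !in_itv/= !andbT gt_max => /andP.
- by move=> n; exists (- n%:R).
- rewrite -subTset => x _; exists (Num.truncn (- x)).+1 => //=.
  by rewrite in_itv/= andbT ltrNl truncnS_gt.
- by move=> _ [x ->]; exact: eqPQoy.
- by move=> n; rewrite (le_lt_trans (probability_le1 _ _)) ?ltry.
Qed.

Section rv_quantile.
Context {d : measure_display} {T : measurableType d} {R : realType}.
Context {P : probability T R} (X : {RV P >-> R}).

Definition rv_quantile (u : R) : R := inf [set x | (u%:E <= cdf X x)%E].

Lemma has_inf_le_cdf (u : R) :
  0 < u < 1 -> has_inf [set x | (u%:E <= cdf X x)%E].
Proof.
move=> /andP[u0 u1]; split.
  apply: contrapT => /set0P/negP/negbNE/eqP/seteqP[cdf_lt _].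
  have : (1 <= u%:E)%E.
    apply: (cvge_le _ (cvg_cdfy1 X)); apply: nearW => x.
    by rewrite leNgt; apply/negP => /ltW/cdf_lt.
  by rewrite leNgt lte_fin u1.
have [lo lo_lt] : exists lo, (cdf X lo < u%:E)%E.
  apply: contrapT => /forallNP cdf_ge; have : (u%:E <= 0)%E.
    apply: (cvge_ge _ (cvg_cdfNy0 X)); apply: nearW => x.
    by rewrite leNgt; apply/negP/cdf_ge.
  by rewrite leNgt lte_fin u0.
exists lo => x /=; apply: contraTle => /ltW/(cdf_nondecreasing X) x_lo.
by rewrite -ltNge (le_lt_trans x_lo).
Qed.

Lemma le_cdf_rv_quantile (u : R) :
  0 < u < 1 -> (u%:E <= cdf X (rv_quantile u))%E.
Proof.
move=> u01; apply: (cvge_ge _ (@cdf_right_continuous _ _ _ _ X _)).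
near=> x; have : rv_quantile u < x by near: x; exact: nbhs_right_gt.
rewrite -subr_gt0 => /inf_adherent/(_ (has_inf_le_cdf u01))[y /= uy].
by rewrite addrC subrK => /ltW/(cdf_nondecreasing X); exact: le_trans.
Unshelve. all: by end_near. Qed.

Lemma rv_quantile_le (u x : R) : 0 < u < 1 ->
  (rv_quantile u <= x) = (u%:E <= cdf X x)%E.
Proof.
move=> u01; apply/idP/idP => [/(cdf_nondecreasing X)|ux].
  exact/le_trans/le_cdf_rv_quantile.
by apply: ge_inf => //; case: (has_inf_le_cdf u01).
Qed.

Lemma measurable_rv_quantile : measurable_fun (`]0, 1[ : set R) rv_quantile.
Proof.
apply: (measurability (RGenOInfty.G (R:=R))) => [|/= _ [_] [x] -> <-].
  exact: RGenOInfty.measurableE.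
have -> : `]0, 1[ `&` rv_quantile @^-1` `]x, +oo[ =
    `]0, 1[ `&` `]fine (cdf X x), +oo[ :> set R.
  apply/seteqP; split=> u /= [u01]; rewrite !in_itv/= !andbT => xu; split=> //;
  rewrite in_itv/= in u01; move: xu;
  by rewrite !ltNge rv_quantile_le// -lee_fin fineK// fin_num_measure.
exact: measurableI.
Qed.

End rv_quantile.

Local Notation unif01 := (uniform_prob ltr01).

Section uniform01.
Context {R : realType}.
Notation leb := (@lebesgue_measure R).

Lemma ge0_integral_unif01 (f : R -> \bar R) :
  measurable_fun setT f -> (forall u, 0 <= f u)%E ->
  (\int[unif01]_u f u = \int[leb]_(u in `]0%R, 1%R[) f u)%E.
Proof.
move=> mf f0; rewrite integral_uniform// subr0 invr1 mul1e.
by rewrite integral_itv_bndoo//; exact: measurable_funTS.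
Qed.

Lemma unif01E (A : set (measurableTypeR R)) : measurable A ->
  unif01 A = leb (A `&` `]0, 1[).
Proof.
move=> mA; rewrite -[in LHS](setIT A) -integral_indic//.
rewrite ge0_integral_unif01//; first by rewrite integral_indic.
exact/measurable_EFinP/measurable_indic.
Qed.

Lemma unif01_itvNyc (c : R) : 0 <= c <= 1 -> unif01 `]-oo, c] = c%:E.
Proof.
move=> /andP[c0 c1]; rewrite -[in LHS](setIT `]-oo, c]) -integral_indic//.
rewrite integral_uniform//; last exact/measurable_EFinP/measurable_indic.
rewrite subr0 invr1 mul1e integral_indic//.
have -> : `]-oo, c] `&` `[0, 1] = `[0, c] :> set R.
  apply/seteqP; split=> u /=; rewrite !in_itv/=; first by case=> -> /andP[->].
  by move=> /andP[-> uc]; rewrite uc (le_trans uc).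
apply: etrans (lebesgue_measure_itv `[0, c]%R) _.
rewrite /= lte_fin oppr0 adde0.
by case: ltgtP c0 => // <-.
Qed.

End uniform01.

Section inverse_transform.
Context {d : measure_display} {T : measurableType d} {R : realType}.
Context {P : probability T R} (X : {RV P >-> R}).

(* Cut off outside `]0, 1[, where the quantile is the infimum of a set that may
   be empty or unbounded, hence a junk value. *)
Definition rv_quantile01 : measurableTypeR R -> R :=
  rv_quantile X \_ `]0, 1[.

Lemma measurable_rv_quantile01 : measurable_fun setT rv_quantile01.
Proof.
apply/measurable_restrict => //; rewrite setTI.
exact: measurable_rv_quantile.
Qed.

HB.instance Definition _ :=
  isMeasurableFun.Build _ _ _ _ rv_quantile01 measurable_rv_quantile01.

Lemma cdf_rv_quantile01 x :
  cdf (rv_quantile01 : {RV unif01 >-> R}) x = cdf X x.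
Proof.
have [c cE] : exists c, cdf X x = c%:E.
  by exists (fine (cdf X x)); rewrite fineK// fin_num_measure.
have c01 : 0 <= c <= 1 by rewrite -!lee_fin -cE cdf_ge0 cdf_le1.
rewrite cE -(unif01_itvNyc c01) [RHS]unif01E//.
apply: etrans (unif01E _) _; first exact: measurable_funPTI.
congr (lebesgue_measure _); apply/seteqP; split=> u /= [+ u01];
  rewrite /rv_quantile01 patchE mem_set// !in_itv/=;
  by rewrite rv_quantile_le ?cE ?lee_fin.
Qed.

Lemma distribution_rv_quantile01 (A : set R) : measurable A ->
  distribution unif01 rv_quantile01 A = distribution P X A.
Proof.
apply: (eq_cdf_probability (P := distribution unif01 rv_quantile01)
  (Q := distribution P X)); exact: cdf_rv_quantile01.
Qed.

Lemma ge0_integral_rv_quantile01 (h : R -> \bar R) :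
  measurable_fun setT h -> (forall x, 0 <= h x)%E ->
  (\int[unif01]_u h (rv_quantile01 u) = \int[distribution P X]_x h x)%E.
Proof.
move=> mh h0; rewrite -(ge0_integral_distribution
  (rv_quantile01 : {RV unif01 >-> R}))//.
by apply: eq_measure_integral => A mA _; exact: distribution_rv_quantile01.
Qed.

End inverse_transform.

Lemma mulr_powRNK {R : realType} (b x y : R) :
  (y = 0 -> x = 0) -> x * y `^ (- b) * y `^ b = x.
Proof.
move=> yx; rewrite -mulrA; have [y0|y_neq0] := eqVneq y 0.
  by rewrite yx// mul0r.
by rewrite -powRD ?addNr ?eqxx// powRr0 mulr1.
Qed.

Lemma integral_gt0 {d : measure_display} {T : measurableType d} {R : realType}
    (mu : {measure set T -> \bar R}) (f : T -> \bar R) :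
  mu setT != 0%E -> measurable_fun setT f -> (forall t, 0 < f t)%E ->
  (0 < \int[mu]_t f t)%E.
Proof.
move=> muT_neq0 mf f0; rewrite lt0e integral_ge0 ?andbT => [|t _]; last first.
  exact: ltW.
apply: contra muT_neq0 => /eqP intf0.
have /ae_eq_integral_abs -/(_ measurableT mf)[N [mN N0 sub]] :
    (\int[mu]_t `|f t| = 0)%E.
  by rewrite -[RHS]intf0; apply: eq_integral => t _; rewrite gee0_abs// ltW.
apply/eqP/(subset_measure0 _ mN _ N0) => // t _; apply: sub => /= /(_ I)/eqP.
by rewrite gt_eqF.
Qed.

Section renyi_integral.
Context {d : measure_display} {T : measurableType d} {R : realType}.
Variable mu : {measure set T -> \bar R}.
Implicit Types (a : R) (f g : T -> R).

Definition renyi_integral a f g : \bar R :=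
  (\int[mu]_t (f t `^ a * g t `^ (1 - a))%:E)%E.

Lemma renyi_integral_ge0 a f g : (0 <= renyi_integral a f g)%E.
Proof.
by apply: integral_ge0 => t _; rewrite lee_fin mulr_ge0 ?powR_ge0.
Qed.

Lemma measurable_renyi_integrand a f g :
  measurable_fun setT f -> measurable_fun setT g ->
  measurable_fun setT (fun t => f t `^ a * g t `^ (1 - a)).
Proof.
by move=> mf mg; apply: measurable_funM;
  exact: (measurableT_comp (measurable_powR _)).
Qed.

Variables (a : R) (f g : T -> R).
Hypotheses (a1 : 1 < a)
  (mf : measurable_fun setT f) (mg : measurable_fun setT g)
  (f0 : forall t, 0 <= f t) (g0 : forall t, 0 <= g t)
  (fg : forall t, g t = 0 -> f t = 0).

(* Hoelder's inequality for f = (f * g `^ - b) * g `^ b with b = (a - 1) / a. *)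
Lemma poweR_integral_le_renyi_integral :
  ((\int[mu]_t (f t)%:E) `^ a <=
   renyi_integral a f g * (\int[mu]_t (g t)%:E) `^ (a - 1))%E.
Proof.
have a0 : 0 < a by exact: lt_trans a1.
have a_neq0 : a != 0 by rewrite gt_eqF.
pose b := (a - 1) / a; have b0 : 0 < b by rewrite divr_gt0// subr_gt0.
have b_neq0 : b != 0 by rewrite gt_eqF.
have baE : b * a = a - 1 by rewrite divfK.
pose F t := f t * g t `^ (- b); pose G t := g t `^ b.
have normFG : ('N[mu]_1[EFin \o (F \* G)%R] = \int[mu]_t (f t)%:E)%E.
  rewrite Lnorm1; apply: eq_integral => t _ /=.
  by rewrite mulr_powRNK ?ger0_norm//; exact: fg.
have normF : ('N[mu]_a%:E[EFin \o F] `^ a = renyi_integral a f g)%E.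
  rewrite poweR_Lnorm//; apply: eq_integral => t _; rewrite /= /F.
  rewrite ger0_norm ?mulr_ge0 ?powR_ge0// powRM ?powR_ge0//.
  by rewrite -powRrM mulNr baE opprB.
have normG : ('N[mu]_b^-1%:E[EFin \o G] `^ a =
    (\int[mu]_t (g t)%:E) `^ (a - 1))%E.
  rewrite -baE -[in LHS](mulKf b_neq0 a) [LHS]poweRrM poweR_Lnorm ?invr_eq0//.
  congr (_ `^ _)%E; apply: eq_integral => t _; rewrite /= /G.
  by rewrite ger0_norm ?powR_ge0// -powRrM divff// powRr1.
rewrite -normF -normG -normFG -poweRM ?Lnorm_ge0//.
apply: gt0_ler_poweR; first exact: ltW.
- by rewrite in_itv/= leey Lnorm_ge0.
- by rewrite in_itv/= leey mule_ge0 ?Lnorm_ge0.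
apply: hoelder; rewrite ?invr_gt0//.
- apply: measurable_funM => //.
  exact: (measurableT_comp (measurable_powR _)).
- exact: (measurableT_comp (measurable_powR _)).
- by rewrite invrK /b mulrBl divff// mul1r subrKC.
Qed.

Lemma powR_mul_le_renyi_integral (x y : R) :
  (\int[mu]_t (f t)%:E = x%:E)%E -> (\int[mu]_t (g t)%:E = y%:E)%E ->
  ((x `^ a * y `^ (1 - a))%:E <= renyi_integral a f g)%E.
Proof.
move=> fx gy; have : (0 <= y%:E)%E.
  by rewrite -gy; apply: integral_ge0 => t _; rewrite lee_fin.
rewrite lee_fin le0r => /predU1P[->|y0].
  by rewrite powR0 ?mulr0 ?renyi_integral_ge0// subr_eq0 lt_eqF.
have := poweR_integral_le_renyi_integral; rewrite fx gy !poweR_EFin.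
by rewrite -(opprB a) powRN EFinM -lee_pdivrMr ?powR_gt0//.
Qed.

End renyi_integral.

Section renyi_integral_mixture.
Context {d d' : measure_display} {T : measurableType d} {U : measurableType d'}.
Context {R : realType} (mu : {sigma_finite_measure set T -> \bar R}).
Variables (nu : {sigma_finite_measure set U -> \bar R}).

Lemma measurable_mixture (f : T * U -> R) (p : T -> R) :
  measurable_fun setT f -> (forall z, 0 <= f z) ->
  (forall t, (\int[nu]_u (f (t, u))%:E = (p t)%:E)%E) -> measurable_fun setT p.
Proof.
move=> mf f0 fp; apply/measurable_EFinP.
have -> : EFin \o p = fubini_F nu (EFin \o f).
  by apply/funext => t; rewrite /= -fp.
apply: measurable_fun_fubini_tonelli_F; first exact/measurable_EFinP.
by move=> z; rewrite lee_fin.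
Qed.

Lemma renyi_integral_mixture_le (a : R) (f g : T * U -> R) (p q : T -> R) :
  1 < a -> measurable_fun setT f -> measurable_fun setT g ->
  (forall z, 0 <= f z) -> (forall z, 0 <= g z) ->
  (forall z, g z = 0 -> f z = 0) ->
  (forall t, (\int[nu]_u (f (t, u))%:E = (p t)%:E)%E) ->
  (forall t, (\int[nu]_u (g (t, u))%:E = (q t)%:E)%E) ->
  (renyi_integral mu a p q <=
   \int[nu]_u renyi_integral mu a (fun t => f (t, u)) (fun t => g (t, u)))%E.
Proof.
move=> a1 mf mg f0 g0 fg fp gq.
pose k z := (f z `^ a * g z `^ (1 - a))%:E.
have mk : measurable_fun setT k.
  exact/measurable_EFinP/measurable_renyi_integrand.
have k0 z : (0 <= k z)%E by rewrite lee_fin mulr_ge0 ?powR_ge0.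
rewrite -(fubini_tonelli k)//; apply: ge0_le_integral => //.
- by move=> t _; rewrite lee_fin mulr_ge0 ?powR_ge0.
- apply/measurable_EFinP/measurable_renyi_integrand.
    exact: measurable_mixture fp.
  exact: measurable_mixture gq.
- exact: measurable_fun_fubini_tonelli_F.
- move=> t _; apply: powR_mul_le_renyi_integral => //.
  + exact: measurable_fun_pair2.
  + exact: measurable_fun_pair2.
  + by move=> u; exact: fg.
Qed.

End renyi_integral_mixture.

Lemma abs_cont_gt0 {R : realType} (P Q : R -> R) :
  (forall y, 0 < Q y) -> abs_cont P Q.
Proof.
move=> Q0; rewrite /abs_cont (_ : mkset _ = set0); first exact: negligible_set0.
by rewrite -subset0 => y [/eqP]; rewrite gt_eqF.
Qed.

Lemma renyi_div_le {R : realType} (a e : R) (P Q : R -> R) : 1 < a ->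
  (renyi_integral (@lebesgue_measure R) a P Q <= (expR ((a - 1) * e))%:E)%E ->
  (renyi_div a P Q <= e%:E)%E.
Proof.
move=> a1; rewrite /renyi_div /renyi_integral; move: (integral _ _ _) => I.
case: I => [r| |]; rewrite ?leye_eq ?leNye// lee_fin => r_le.
case: ifPn => [r0|_]; rewrite ?leNye// lee_fin.
by rewrite ler_pdivrMr ?subr_gt0// mulrC -ler_expR lnK.
Qed.

Section density_quantile.
Context {R : realType}.
Implicit Types (p q : R -> R).
Notation leb := (@lebesgue_measure R).

Local Notation density_law pd :=
  (density_prob leb (proj1 pd) (proj1 (proj2 pd)) (proj2 (proj2 pd))).

Let idTR : measurableTypeR R -> R := idfun.

#[local] HB.instance Definition _ :=
  @isMeasurableFun.Build _ _ _ _ idTR (@measurable_id _ _ setT).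

Definition quantile01 p (pd : is_density p) : measurableTypeR R -> R :=
  rv_quantile01 (idTR : {RV density_law pd >-> R}).

Lemma quantile01E p (pd : is_density p) (u : R) : `]0, 1[ u ->
  quantile01 pd u = quantile p u.
Proof.
move=> u01; rewrite /quantile01 /rv_quantile01 patchE mem_set//.
rewrite /rv_quantile /quantile; congr inf.
apply/funext => x; apply/propext; rewrite /= -lee_fin /Defs.cdf fineK//.
exact: (fin_num_measure (density_law pd)).
Qed.

Lemma measurable_quantile01 p (pd : is_density p) :
  measurable_fun setT (quantile01 pd).
Proof. exact: measurable_rv_quantile01. Qed.

Lemma ge0_integral_quantile01 p (pd : is_density p) (h : R -> \bar R) :
  measurable_fun setT h -> (forall x, 0 <= h x)%E ->
  (\int[unif01]_u h (quantile01 pd u) = \int[leb]_x (h x * (p x)%:E))%E.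
Proof.
move=> mh h0; rewrite ge0_integral_rv_quantile01//.
by rewrite ge0_integral_distribution// ge0_integral_density_prob.
Qed.

Lemma comonotone_integralE p q (pd : is_density p) (qd : is_density q)
    (c : R -> R -> R) :
  measurable_fun setT (fun u => (c (quantile01 pd u) (quantile01 qd u))%:E) ->
  (forall x x', 0 <= c x x') ->
  comonotone_integral p q c =
  (\int[unif01]_u (c (quantile01 pd u) (quantile01 qd u))%:E)%E.
Proof.
move=> mc c0; rewrite ge0_integral_unif01//; last by move=> u; rewrite lee_fin.
by apply: eq_integral => u /set_mem u01; rewrite !quantile01E.
Qed.

Lemma le_comonotone_integral p q (c c' : R -> R -> R) :
  is_density p -> is_density q ->
  measurable_fun setT (fun z : R * R => c z.1 z.2) ->
  measurable_fun setT (fun z : R * R => c' z.1 z.2) ->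
  (forall x x', 0 <= c x x') -> (forall x x', c x x' <= c' x x') ->
  (comonotone_integral p q c <= comonotone_integral p q c')%E.
Proof.
move=> pd qd mc mc' c0 cc'.
have mQ (e : R -> R -> R) : measurable_fun setT (fun z : R * R => e z.1 z.2) ->
    measurable_fun setT (fun u => (e (quantile01 pd u) (quantile01 qd u))%:E).
  move=> me; apply/measurable_EFinP.
  apply: (measurableT_comp me
    (g := fun u => (quantile01 pd u, quantile01 qd u))).
  by apply: measurable_fun_pair; exact: measurable_quantile01.
have c'0 x x' : 0 <= c' x x' by exact: le_trans (cc' x x').
rewrite (comonotone_integralE (mQ _ mc) c0).
rewrite (comonotone_integralE (mQ _ mc') c'0).
apply: ge0_le_integral => //; [|exact: mQ|exact: mQ|].
- by move=> u _; rewrite lee_fin.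
- by move=> u _; rewrite lee_fin.
Qed.

End density_quantile.

Section additive_noise.
Context {R : realType} (pN : R -> R) (K : R).
Notation leb := (@lebesgue_measure R).
Hypotheses (mN : measurable_fun setT pN) (pN_le : forall z, pN z <= K).

Let measurable_noise_quantile p (pd : is_density p) :
  measurable_fun setT (fun z : measurableTypeR R * measurableTypeR R =>
    pN (z.1 - quantile01 pd z.2)).
Proof.
apply: (measurableT_comp mN); apply: measurable_funB.
  exact: measurable_fst.
apply: measurableT_comp; [exact: measurable_quantile01|].
exact: measurable_snd.
Qed.

Let measurable_noise_quantile_at p (pd : is_density p) (y : R) :
  measurable_fun setT (fun u => pN (y - quantile01 pd u)).
Proof. exact: (measurable_fun_pair2 y (measurable_noise_quantile pd)). Qed.

Lemma conv_density_quantile p (pd : is_density p) (y : R) :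
  (forall z, 0 <= pN z) ->
  (\int[unif01]_u (pN (y - quantile01 pd u))%:E = (conv_density pN p y)%:E)%E.
Proof.
move=> pN_ge0; have mNy : measurable_fun setT (fun x : R => (pN (y - x))%:E).
  by apply/measurable_EFinP/(measurableT_comp mN); exact: measurable_funB.
have pNy0 x : (0 <= (pN (y - x))%:E)%E by rewrite lee_fin.
rewrite /conv_density; under [in RHS]eq_integral do rewrite EFinM.
rewrite -(ge0_integral_quantile01 pd mNy)// fineK//.
rewrite ge0_fin_numE ?integral_ge0//.
apply: (@le_lt_trans _ _ (\int[unif01]_u K%:E)%E); last first.
  by rewrite integral_cst// [X in (_ * X)%E]probability_setT mule1 ltry.
apply: ge0_le_integral => //; last by move=> u _; rewrite lee_fin.
by apply/measurable_EFinP; exact: measurable_noise_quantile_at.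
Qed.

Hypothesis pN_gt0 : forall z, 0 < pN z.

Let pN_ge0 z : 0 <= pN z. Proof. exact: ltW. Qed.

Lemma conv_density_gt0 p (y : R) : is_density p -> 0 < conv_density pN p y.
Proof.
move=> pd; rewrite -lte_fin -(conv_density_quantile pd)//.
apply: integral_gt0 => [||u]; last by rewrite lte_fin.
- by rewrite [X in X != _]probability_setT oner_neq0.
- by apply/measurable_EFinP; exact: measurable_noise_quantile_at.
Qed.

Lemma renyi_integral_conv_le (a : R) (c : R -> R -> R) p q :
  1 < a -> is_density p -> is_density q ->
  (forall x x', renyi_integral leb a
     (fun y => pN (y - x)) (fun y => pN (y - x')) = (c x x')%:E) ->
  (renyi_integral leb a (conv_density pN p) (conv_density pN q) <=
   comonotone_integral p q c)%E.
Proof.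
move=> a1 pd qd cE.
have c0 x x' : 0 <= c x x' by rewrite -lee_fin -cE renyi_integral_ge0.
have [mf mg] := (measurable_noise_quantile pd, measurable_noise_quantile qd).
rewrite (comonotone_integralE (pd := pd) (qd := qd))//; last first.
  under eq_fun do rewrite -cE.
  apply: (measurable_fun_fubini_tonelli_G (m1 := leb) (fun z =>
    (pN (z.1 - quantile01 pd z.2) `^ a *
     pN (z.1 - quantile01 qd z.2) `^ (1 - a))%:E)).
    exact/measurable_EFinP/measurable_renyi_integrand.
  by move=> z; rewrite lee_fin mulr_ge0 ?powR_ge0.
under eq_integral do rewrite -cE.
apply: (renyi_integral_mixture_le leb a1 mf mg) => //.
- by move=> z /eqP; rewrite gt_eqF.
- by move=> y; exact: conv_density_quantile.
- by move=> y; exact: conv_density_quantile.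
Qed.

End additive_noise.

Section gauss_renyi_integral.
Context {R : realType}.
Implicit Types (a s x : R) (p q : R -> R).

Definition gauss_renyi_integral a s x x' : R :=
  expR (a * (a - 1) * (x - x') ^+ 2 / (2 * s)).

Lemma measurable_gauss_renyi_integral a s :
  measurable_fun setT (fun z : R * R => gauss_renyi_integral a s z.1 z.2).
Proof.
apply: measurableT_comp => //; apply: measurable_funM => //.
by apply: measurable_funM => //; apply: measurable_funX; exact: measurable_funB.
Qed.

Lemma gauss_renyi_integral_nincr a s t x x' :
  1 < a -> 0 < s -> s <= t ->
  gauss_renyi_integral a t x x' <= gauss_renyi_integral a s x x'.
Proof.
move=> a1 s0 st; have t0 := lt_le_trans s0 st.
rewrite ler_expR ler_wpM2l//.
  by rewrite mulr_ge0 ?sqr_ge0// mulr_ge0// ltW// ?subr_gt0// (lt_trans _ a1).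
by rewrite lef_pV2 ?posrE ?mulr_gt0// ler_pM2l.
Qed.

Lemma le_comonotone_gauss_renyi_integral a s t p q :
  1 < a -> 0 < s -> s <= t -> is_density p -> is_density q ->
  (comonotone_integral p q (gauss_renyi_integral a t) <=
   comonotone_integral p q (gauss_renyi_integral a s))%E.
Proof.
move=> a1 s0 st pd qd; apply: le_comonotone_integral => //.
- exact: measurable_gauss_renyi_integral.
- exact: measurable_gauss_renyi_integral.
- by move=> x x'; exact: expR_ge0.
- by move=> x x'; exact: gauss_renyi_integral_nincr.
Qed.

End gauss_renyi_integral.

Section gauss.
Context {R : realType} (s2 : R).
Hypothesis s2_gt0 : 0 < s2.
Notation leb := (@lebesgue_measure R).

Let sqrt_s2_neq0 : Num.sqrt s2 != 0. Proof. by rewrite gt_eqF// sqrtr_gt0. Qed.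

Lemma gauss_normal_pdf (m y : R) :
  gauss s2 (y - m) = normal_pdf m (Num.sqrt s2) y.
Proof.
rewrite normal_pdfE// /normal_fun /normal_peak sqr_sqrtr ?(ltW s2_gt0)//.
rewrite /gauss -sqrtrM ?mulr_ge0 ?pi_ge0//.
by rewrite -(mulr_natl s2) -(mulr_natl (s2 * pi)) mulrAC mulrA.
Qed.

Let gauss_peak_gt0 : 0 < (Num.sqrt (2 * pi) * Num.sqrt s2)^-1 :> R.
Proof. by rewrite invr_gt0 mulr_gt0// sqrtr_gt0// mulr_gt0// pi_gt0. Qed.

Lemma gauss_gt0 z : 0 < gauss s2 z.
Proof. by rewrite mulr_gt0// expR_gt0. Qed.

Lemma gauss_le_peak z : gauss s2 z <= normal_peak (Num.sqrt s2).
Proof. by rewrite -[z]subr0 gauss_normal_pdf normal_pdf_ub. Qed.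

Lemma measurable_gauss : measurable_fun setT (gauss s2).
Proof.
rewrite (_ : gauss s2 = normal_pdf 0 (Num.sqrt s2)).
  exact: measurable_normal_pdf.
by apply/funext => z; rewrite -gauss_normal_pdf subr0.
Qed.

Lemma gauss_powR_mul (a x x' y : R) :
  gauss s2 (y - x) `^ a * gauss s2 (y - x') `^ (1 - a) =
  gauss_renyi_integral a s2 x x' * gauss s2 (y - (a * x + (1 - a) * x')).
Proof.
have gaussE z : gauss s2 z =
    expR (ln (Num.sqrt (2 * pi) * Num.sqrt s2)^-1 - z ^+ 2 / (2 * s2)).
  by rewrite expRD -mulNr lnK.
rewrite !gaussE; move: (ln _) => k.
rewrite -!expRM -!expRD; congr expR; field.
by rewrite gt_eqF.
Qed.

Lemma renyi_integral_gauss (a x x' : R) :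
  renyi_integral leb a
    (fun y => gauss s2 (y - x)) (fun y => gauss s2 (y - x')) =
  (gauss_renyi_integral a s2 x x')%:E.
Proof.
rewrite /renyi_integral.
under eq_integral do rewrite gauss_powR_mul gauss_normal_pdf EFinM.
rewrite ge0_integralZl//; first by rewrite integral_normal_pdf mule1.
- by apply/measurable_EFinP; exact: measurable_normal_pdf.
- by move=> y _; rewrite lee_fin normal_pdf_ge0.
- by rewrite lee_fin expR_ge0.
Qed.

End gauss.

Lemma conv_gauss_gt0 {R : realType} (s2 : R) (p : R -> R) (y : R) :
  0 < s2 -> is_density p -> 0 < conv_density (gauss s2) p y.
Proof.
move=> s20; exact: (conv_density_gt0 (measurable_gauss s20) (gauss_le_peak s20)
  (gauss_gt0 s20)).
Qed.

Lemma renyi_integral_conv_gauss_le {R : realType} (a s2 : R) (p q : R -> R) :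
  1 < a -> 0 < s2 -> is_density p -> is_density q ->
  (renyi_integral (@lebesgue_measure R) a
     (conv_density (gauss s2) p) (conv_density (gauss s2) q) <=
   comonotone_integral p q (gauss_renyi_integral a s2))%E.
Proof.
move=> a1 s20 pd qd.
apply: (renyi_integral_conv_le (measurable_gauss s20) (gauss_le_peak s20)
  (gauss_gt0 s20)) => // x x'.
exact: renyi_integral_gauss.
Qed.

Theorem theorem2 (R : realType) (Sec Prior : Type) (SS : Sec -> Sec -> Prop)
    (pX : Sec -> Prior -> R -> R) (eps alpha : R)
    (sig2 : Sec -> Sec -> Prior -> R) (s2 : R) :
  0 < eps -> 1 < alpha ->
  (forall s rho, is_density (pX s rho)) ->
  (forall si sj rho, SS si sj ->
     0 < sig2 si sj rho /\
     comonotone_integral (pX si rho) (pX sj rho)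
       (fun x x' => expR (alpha * (alpha - 1) * (x - x') ^+ 2
                          / (2 * sig2 si sj rho)))
     = (expR ((alpha - 1) * eps))%:E) ->
  (* s2 is the maximum of sig2 over all pairs in SS and all priors *)
  (forall si sj rho, SS si sj -> sig2 si sj rho <= s2) ->
  (exists si sj rho, SS si sj /\ sig2 si sj rho = s2) ->
  renyi_pufferfish SS
    (fun s rho => conv_density (gauss s2) (pX s rho)) alpha eps.
Proof.
move=> _ alpha1 pXd sig2P sig2_le _ rho si sj Sij.
have [sig20 sig2E] := sig2P _ _ rho Sij.
have s20 : 0 < s2 := lt_le_trans sig20 (sig2_le _ _ rho Sij).
split; first by apply: abs_cont_gt0 => y; exact: conv_gauss_gt0.
apply: renyi_div_le => //; rewrite -sig2E.
apply: (le_trans (renyi_integral_conv_gauss_le alpha1 s20 _ _)) => //.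
by apply: le_comonotone_gauss_renyi_integral => //; exact: sig2_le.
Qed.
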